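(* Under the standing setup, assume $\dim G_{\lambda_1}<d-1$. Let $(v^k)$, $(x^k)$ be generated by Algorithm U and let $\alpha_k=b_kd_k-a_ke_k$, where $a_k=\|Av^k\|^2$, $b_k=\langle Av^k,Ax^k\rangle$, $d_k=\|Bv^k\|^2$, $e_k=\langle Bv^k,Bx^k\rangle$. Then $\alpha_k\to0$ as $k\to\infty$ almost surely.
   Context: Standing setup. Let $d\ge 2$, $A\in\mathbb R^{m\times d}$, $B\in\mathbb R^{\ell\times d}$ with $\ker B=\{0\}$, so $B^TB$ is symmetric positive definite. $\mathbb S^{d-1}$ is the Euclidean unit sphere of $\mathbb R^d$ and $\mathcal U(\mathbb S^{d-1})$ the uniform (normalized surface) probability measure on it. Define $f(v)=\|Av\|^2/\|Bv\|^2$ for $v\neq0$. A generalized eigenvector of $(A^TA,B^TB)$ is a vector $v\neq 0$ with $A^TAv=\lambda B^TBv$ for some $\lambda\in\mathbb R$ (a generalized eigenvalue); the generalized eigenvalues are exactly the eigenvalues of the symmetric matrix $K=(B^TB)^{-1/2}A^TA(B^TB)^{-1/2}$, listed with multiplicity as $\lambda_1\ge\lambda_2\ge\dots\ge\lambda_d$. For a generalized eigenvalue $\lambda$ let $G_\lambda=\{v\in\mathbb R^d\setminus\{0\}: A^TAv=\lambda B^TBv\}$, and $\dim G_\lambda$ denotes the dimension of the linear subspace $G_\lambda\cup\{0\}$. Algorithm U. Let $g\sim\mathcal N(0,I_d)$ and $v^0=g/\|g\|$; let $x^0,x^1,x^2,\dots$ be i.i.d. with law $\mathcal U(\mathbb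 S^{d-1})$, independent of $g$. Given $v^k\in\mathbb S^{d-1}$, set $s_k(\tau)=f(v^k+\tau x^k)$ for $\tau\in\mathbb R$ with $v^k+\tau x^k\neq0$; let $\tau_k$ be a (measurably chosen) maximizer of $s_k$ over $\tau\in\mathbb R$, with $\tau_k=0$ if no maximizer exists, and set $v^{k+1}=(v^k+\tau_kx^k)/\|v^k+\tau_kx^k\|$. *)

(* Defs.v *)
From HB Require Import structures.
From mathcomp Require Import all_boot all_order all_algebra.
From mathcomp Require Import all_classical all_reals all_analysis.
Set Implicit Arguments. Unset Strict Implicit. Unset Printing Implicit Defensive.
Import Order.TTheory GRing.Theory Num.Theory.
Import numFieldNormedType.Exports.
Local Open Scope classical_set_scope.
Local Open Scope ring_scope.

Section Defs.
Variable R : realType.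

Definition dotv n (u w : 'cV[R]_n) : R := \sum_(i < n) u i 0 * w i 0.
Definition nsq n (u : 'cV[R]_n) : R := dotv u u.
Definition enorm n (u : 'cV[R]_n) : R := Num.sqrt (nsq u).

Definition fquot m l d (A : 'M[R]_(m, d)) (B : 'M[R]_(l, d)) (v : 'cV[R]_d) : R :=
  nsq (A *m v) / nsq (B *m v).

Definition gen_eigvec m l d (A : 'M[R]_(m, d)) (B : 'M[R]_(l, d)) (lam : R)
  (v : 'cV[R]_d) : Prop :=
  v <> 0 /\ (A^T *m A) *m v = lam *: ((B^T *m B) *m v).
Definition gen_eigval m l d (A : 'M[R]_(m, d)) (B : 'M[R]_(l, d)) (lam : R) : Prop :=
  exists v, gen_eigvec A B lam v.
Definition largest_gen_eigval m l d (A : 'M[R]_(m, d)) (B : 'M[R]_(l, d)) (lam : R)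
  : Prop := gen_eigval A B lam /\ forall mu, gen_eigval A B mu -> mu <= lam.
(** dim G_lam = dimension of the subspace {v | A^T A v = lam B^T B v}
    (the kernel of the symmetric matrix A^T A - lam B^T B; mxalgebra's
    kermx is the row kernel, hence the transpose). *)
Definition dimG m l d (A : 'M[R]_(m, d)) (B : 'M[R]_(l, d)) (lam : R) : nat :=
  \rank (kermx (A^T *m A - lam *: (B^T *m B))^T).

Definition borelV d : set (set 'cV[R]_d) :=
  <<s [set (fun v : 'cV[R]_d => v i 0) @^-1` E | i in [set: 'I_d] &
        E in [set E : set R | measurable E]] >>.

(** d-dimensional Lebesgue integral of a nonnegative function, as the
    iterated (Tonelli) integral over the coordinates. *)
Definition setcoord d (y : 'cV[R]_d) (j : nat) (t : R) : 'cV[R]_d :=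
  \col_i (if (i : nat) == j then t else y i 0).
Fixpoint leb_iter d (n : nat) (h : 'cV[R]_d -> \bar R) (y : 'cV[R]_d) : \bar R :=
  match n with
  | O => h y
  | S k => (\int[@lebesgue_measure R]_t leb_iter k h (setcoord y k t))%E
  end.
Definition lebV d (h : 'cV[R]_d -> \bar R) : \bar R := leb_iter d h 0.
Definition lebV_set d (E : set 'cV[R]_d) : \bar R := lebV (fun y => (\1_E y)%:E).

Definition sphere d : set 'cV[R]_d := [set v | enorm v = 1].
Definition uball d : set 'cV[R]_d := [set v | enorm v <= 1].
Definition cone01 d (F : set 'cV[R]_d) : set 'cV[R]_d :=
  [set t *: y | t in [set t : R | 0 < t <= 1] & y in F].

(** Normalized surface (uniform probability) measure on S^{d-1}, as the
    normalized cone measure: U(F) = Leb(cone(F)) / Leb(ball). *)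
Definition unif_sphere d (E : set 'cV[R]_d) : R :=
  fine (lebV_set (cone01 (E `&` @sphere d))) / fine (lebV_set (@uball d)).

Definition gauss_density d (y : 'cV[R]_d) : R :=
  (Num.sqrt (2 * pi))^-1 ^+ d * expR (- nsq y / 2).
Definition gauss_std d (E : set 'cV[R]_d) : \bar R :=
  lebV (fun y => (\1_E y * gauss_density y)%:E).

Section Prob.
Context (d0 : measure_display) (Omega : measurableType d0) (P : probability Omega R).

Definition rand_vec d (X : Omega -> 'cV[R]_d) : Prop :=
  forall E, borelV E -> measurable (X @^-1` E).

Definition mutually_indep (I : choiceType) d (X : I -> Omega -> 'cV[R]_d) : Prop :=
  forall (J : seq I) (E : I -> set 'cV[R]_d), uniq J ->
    (forall j, j \in J -> borelV (E j)) ->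
    P (\bigcap_(j in [set j | j \in J]) (X j @^-1` E j)) =
    (\prod_(j <- J) P (X j @^-1` E j))%E.

Definition law_unif_sphere d (X : Omega -> 'cV[R]_d) : Prop :=
  forall E, borelV E -> P (X @^-1` E) = (unif_sphere E)%:E.
Definition law_gauss_std d (X : Omega -> 'cV[R]_d) : Prop :=
  forall E, borelV E -> P (X @^-1` E) = gauss_std E.
End Prob.

Definition is_maximizer m l d (A : 'M[R]_(m, d)) (B : 'M[R]_(l, d))
  (v x : 'cV[R]_d) (tau : R) : Prop :=
  v + tau *: x <> 0 /\
  forall t, v + t *: x <> 0 -> fquot A B (v + t *: x) <= fquot A B (v + tau *: x).

End Defs.

(* Main.v *)
Require Import Defs.
From HB Require Import structures.
From mathcomp Require Import all_boot all_order all_algebra.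
From mathcomp Require Import all_classical all_reals all_analysis.
From mathcomp Require Import measurable_realfun ring lra.
Set Implicit Arguments. Unset Strict Implicit. Unset Printing Implicit Defensive.
Import Order.TTheory GRing.Theory Num.Theory.
Import numFieldNormedType.Exports.
Local Open Scope classical_set_scope.
Local Open Scope ring_scope.

(** Write [s] for the quotient along the line [v + t x]. Its derivative is a positive multiple of [alpha + beta t - gamma t^2], where [gamma] is proportional to the derivative at infinity. If [gamma <> 0] the maximizer exists and is the unique root [(beta + sqrt (beta^2 + 4 alpha gamma)) / (2 gamma)]. One step of exact line search from a unit vector increases [fquot] by at least a constant multiple of [alpha^2]; as [fquot] is bounded, [alpha] tends to [0] along every trajectory on which [gamma] never vanishes.

For fixed [v <> 0], [gamma] is a polynomial in [x], not identically zero unless [A^T A] is a multiple of [B^T B], so its zero set is null for the uniform law on the sphere. By Fubini, [gamma] almost surely never vanishes once the iterate [v k] is known to be independent of [x k]. Up to a nonzero scalar factor, [v k] is an explicit measurable function of [g, x 0, ..., x (k-1)], and the independence follows by induction on [k]. *)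

(** * Euclidean forms and two-sided bounds for matrices *)

Section EuclideanForms.
Context {R : realType}.

Lemma dotvC n (u w : 'cV[R]_n) : dotv u w = dotv w u.
Proof. by apply: eq_bigr => i _; rewrite mulrC. Qed.

Lemma dotvDl n (u u' w : 'cV[R]_n) : dotv (u + u') w = dotv u w + dotv u' w.
Proof. by rewrite -big_split; apply: eq_bigr => i _; rewrite mxE mulrDl. Qed.

Lemma dotvZl n (t : R) (u w : 'cV[R]_n) : dotv (t *: u) w = t * dotv u w.
Proof. by rewrite /dotv mulr_sumr; apply: eq_bigr => i _; rewrite mxE mulrA. Qed.

Lemma dotvDr n (u w w' : 'cV[R]_n) : dotv u (w + w') = dotv u w + dotv u w'.
Proof. by rewrite dotvC dotvDl !(dotvC u). Qed.

Lemma dotvZr n (t : R) (u w : 'cV[R]_n) : dotv u (t *: w) = t * dotv u w.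
Proof. by rewrite dotvC dotvZl dotvC. Qed.

Lemma nsqZ n (t : R) (u : 'cV[R]_n) : nsq (t *: u) = t ^+ 2 * nsq u.
Proof. by rewrite /nsq dotvZl dotvZr mulrA expr2. Qed.

Lemma nsqD n (u w : 'cV[R]_n) : nsq (u + w) = nsq u + 2 * dotv u w + nsq w.
Proof. by rewrite /nsq dotvDl !dotvDr (dotvC w u); ring. Qed.

Lemma nsq_ge0 n (u : 'cV[R]_n) : 0 <= nsq u.
Proof. by apply: sumr_ge0 => i _; rewrite -expr2 sqr_ge0. Qed.

Lemma nsq_eq0 n (u : 'cV[R]_n) : nsq u = 0 -> u = 0.
Proof.
move=> /eqP; rewrite psumr_eq0 => [|i _]; last by rewrite -expr2 sqr_ge0.
move=> /allP u0; apply/matrixP => i j; rewrite ord1 mxE.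
by have /implyP/(_ isT) := u0 i (mem_index_enum _); rewrite mulf_eq0 orbb => /eqP.
Qed.

Lemma nsq0 n : nsq (0 : 'cV[R]_n) = 0.
Proof. by rewrite -(scale0r 0) nsqZ expr0n mul0r. Qed.

Lemma dotv0r n (u : 'cV[R]_n) : dotv u 0 = 0.
Proof. by apply: big1 => i _; rewrite mxE mulr0. Qed.

Lemma nsq_gt0 n (u : 'cV[R]_n) : u != 0 -> 0 < nsq u.
Proof.
move=> u0; rewrite lt_neqAle nsq_ge0 andbT eq_sym.
by apply: contra u0 => /eqP/nsq_eq0 ->.
Qed.

Lemma enorm_gt0 n (u : 'cV[R]_n) : u != 0 -> 0 < enorm u.
Proof. by move=> u0; rewrite sqrtr_gt0 nsq_gt0. Qed.

Lemma nsq_normalize n (u : 'cV[R]_n) : u != 0 -> nsq ((enorm u)^-1 *: u) = 1.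
Proof.
move=> u0; rewrite nsqZ exprVn /enorm sqr_sqrtr ?nsq_ge0// mulVf//.
by rewrite gt_eqF// nsq_gt0.
Qed.

(** Cauchy-Schwarz: the squared norm of [nsq w *: u - dotv u w *: w] is [nsq w] times the gap
    between the two sides. *)
Lemma dotv_sqr_le n (u w : 'cV[R]_n) : dotv u w ^+ 2 <= nsq u * nsq w.
Proof.
have [/nsq_eq0 ->|/eqP w0] := eqVneq (nsq w) 0.
  by rewrite nsq0 dotv0r expr0n mulr0.
have w_gt0 : 0 < nsq w by rewrite lt_neqAle nsq_ge0 eq_sym andbT; exact/eqP.
have := nsq_ge0 (nsq w *: u + (- dotv u w) *: w).
rewrite nsqD !nsqZ dotvZl dotvZr => h.
suff : 0 <= nsq w * (nsq u * nsq w - dotv u w ^+ 2).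
  by rewrite pmulr_rge0// subr_ge0.
by apply: le_trans h _; rewrite le_eqVlt; apply/orP; left; apply/eqP; ring.
Qed.

(** Cauchy-Schwarz on each row; the constant is the squared Frobenius norm. *)
Lemma mulmx_nsq_bounded p n (M : 'M[R]_(p, n)) :
  exists2 K : R, 0 <= K & forall w : 'cV[R]_n, nsq (M *m w) <= K * nsq w.
Proof.
exists (\sum_(i < p) nsq (row i M)^T) => [|w].
  by apply: sumr_ge0 => i _; exact: nsq_ge0.
rewrite /nsq mulr_suml; apply: ler_sum => i _; rewrite -/(nsq _) -/(nsq w).
have -> : (M *m w) i 0 = dotv (row i M)^T w.
  by rewrite mxE; apply: eq_bigr => j _; rewrite !mxE.
by rewrite -expr2 dotv_sqr_le.
Qed.

(** An injective matrix has a left inverse, and the upper bound for that inverse is the lower bound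
    for [M]; no compactness of the sphere enters. *)
Lemma injective_nsq_lower_bound p n (M : 'M[R]_(p, n)) :
  (forall w : 'cV[R]_n, M *m w = 0 -> w = 0) ->
  exists2 K : R, 0 <= K & forall w : 'cV[R]_n, nsq w <= K * nsq (M *m w).
Proof.
move=> Minj.
have /row_freeP[L ML] : row_free M^T.
  rewrite -kermx_eq0; apply/eqP/row_matrixP => i; rewrite row0.
  have : row i (kermx M^T) *m M^T = 0.
    by rewrite -row_mul mulmx_ker row0.
  move=> /(congr1 trmx); rewrite trmx_mul trmxK trmx0 => /Minj.
  by move=> /(congr1 trmx); rewrite trmxK trmx0.
have [K K0 HK] := mulmx_nsq_bounded L^T.
exists K => // w; have := HK (M *m w); rewrite mulmxA.
suff -> : L^T *m M = 1%:M by rewrite mul1mx.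
by apply: trmx_inj; rewrite trmx_mul trmxK ML trmx1.
Qed.

End EuclideanForms.

(** * Quotients of two quadratic polynomials in one variable *)

Section RationalQuadratic.
Context {R : realType}.
Variables a b c p e q : R.
Let alpha := b * p - a * e.
Let beta := c * p - a * q.
Let gamma := b * q - c * e.
Let disc := beta ^+ 2 + 4 * alpha * gamma.

(* Up to the factor [p ^+ 2], the discriminant is the positive definite binary form [p^2 X^2 - 4 p e X Y + 4 p q Y^2] in [(beta, alpha)], because [gamma p = alpha q - e beta]. *)
Lemma quotient_disc_gt0 : 0 < p -> e ^+ 2 < p * q -> gamma != 0 -> 0 < disc.
Proof.
move=> p0 eq gam0.
have E : p ^+ 2 * disc =
    (p * beta - 2 * e * alpha) ^+ 2 + 4 * (p * q - e ^+ 2) * alpha ^+ 2.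
  by rewrite /disc /alpha /beta /gamma; ring.
have pq : 0 < p * q - e ^+ 2 by rewrite subr_gt0.
rewrite -(pmulr_rgt0 _ (exprn_gt0 2 p0)) E.
have [al0|al0] := eqVneq alpha 0; last first.
  apply: ltr_wpDl; first exact: sqr_ge0.
  by apply: mulr_gt0; [rewrite mulr_gt0|rewrite exprn_even_gt0].
rewrite al0 expr0n !mulr0 subr0 addr0 exprn_even_gt0//= mulf_neq0 ?(gt_eqF p0)//.
apply: contra gam0 => /eqP be0.
have : p * gamma = alpha * q - e * beta.
  by rewrite /alpha /beta /gamma; ring.
rewrite al0 be0 mul0r mulr0 subr0 => /eqP.
by rewrite mulf_eq0 gt_eqF.
Qed.

(** The cross-multiplied difference is quadratic in [t - s] without constant term. Its linear
    coefficient is twice [alpha + beta s - gamma s^2], which vanishes at the critical point, and its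
    leading coefficient is [beta - 2 gamma s = - r]. For [r >= 0] this makes [s] a global
    maximizer. *)
Lemma quotient_gap (s t r : R) : gamma != 0 -> r ^+ 2 = disc ->
  2 * gamma * s = beta + r ->
  (a + 2 * t * b + t ^+ 2 * c) * (p + 2 * s * e + s ^+ 2 * q)
  - (a + 2 * s * b + s ^+ 2 * c) * (p + 2 * t * e + t ^+ 2 * q)
  = - r * (t - s) ^+ 2.
Proof.
move=> gam0 r2 sE.
have root : alpha + beta * s - gamma * s ^+ 2 = 0.
  (* The factor [4 gamma] completes the square, so that [s] enters only through [2 gamma s], known
     from [sE]. *)
  suff /eqP : 4 * gamma * (alpha + beta * s - gamma * s ^+ 2) = 0.
    by rewrite mulf_eq0 (mulf_eq0 4) (negbTE gam0) orbF pnatr_eq0 => /eqP.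
  have -> : 4 * gamma * (alpha + beta * s - gamma * s ^+ 2) =
    4 * alpha * gamma + 2 * beta * (2 * gamma * s) - (2 * gamma * s) ^+ 2.
    by ring.
  rewrite sE; have -> : 4 * alpha * gamma = r ^+ 2 - beta ^+ 2.
    by rewrite r2 /disc; ring.
  by ring.
have -> : r = 2 * gamma * s - beta by rewrite sE; ring.
transitivity ((t - s) * (2 * (alpha + beta * s - gamma * s ^+ 2)
  + (beta - 2 * gamma * s) * (t - s))); last by rewrite root; ring.
by rewrite /alpha /beta /gamma; ring.
Qed.

Lemma quotient_diff (t : R) : 0 < p -> 0 < p + 2 * t * e + t ^+ 2 * q ->
  (a + 2 * t * b + t ^+ 2 * c) / (p + 2 * t * e + t ^+ 2 * q) - a / p
  = (2 * alpha * t + beta * t ^+ 2) / (p * (p + 2 * t * e + t ^+ 2 * q)).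
Proof.
move=> p0 m0; rewrite /alpha /beta; field.
by rewrite !gt_eqF.
Qed.

End RationalQuadratic.

(** * Exact line search along one direction *)

Section LineSearch.
Context {R : realType} {m l d : nat}.
Variables (A : 'M[R]_(m, d)) (B : 'M[R]_(l, d)).
Hypothesis Binj : forall w : 'cV[R]_d, B *m w = 0 -> w = 0.
Implicit Types v x y z : 'cV[R]_d.

Definition ls_alpha v x : R :=
  dotv (A *m v) (A *m x) * nsq (B *m v) - nsq (A *m v) * dotv (B *m v) (B *m x).
Definition ls_beta v x : R :=
  nsq (A *m x) * nsq (B *m v) - nsq (A *m v) * nsq (B *m x).
Definition ls_gamma v x : R :=
  dotv (A *m v) (A *m x) * nsq (B *m x) - nsq (A *m x) * dotv (B *m v) (B *m x).
Definition ls_disc v x : R :=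
  ls_beta v x ^+ 2 + 4 * ls_alpha v x * ls_gamma v x.

(* [2 gamma] times the point [v + tau x] reached by exact line search; clearing the denominator makes the step positively homogeneous of degree 2 in [v]. *)
Definition ls_step v x : 'cV[R]_d :=
  (2 * ls_gamma v x) *: v + (ls_beta v x + Num.sqrt (ls_disc v x)) *: x.
Definition ls_tau v x : R :=
  (ls_beta v x + Num.sqrt (ls_disc v x)) / (2 * ls_gamma v x).

Lemma nsqB_gt0 w : w != 0 -> 0 < nsq (B *m w).
Proof. by move=> w0; apply: nsq_gt0; apply: contra w0 => /eqP/Binj ->. Qed.

Lemma nsq_line p (M : 'M[R]_(p, d)) v x t : nsq (M *m (v + t *: x)) =
  nsq (M *m v) + 2 * t * dotv (M *m v) (M *m x) + t ^+ 2 * nsq (M *m x).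
Proof. by rewrite mulmxDr -scalemxAr nsqD nsqZ dotvZr; ring. Qed.

(** Hence [ls_gamma v x != 0] forces [v] and [x] to be linearly independent, which keeps the
    denominators below away from zero. *)
Lemma ls_gamma_scaled x t : ls_gamma (t *: x) x = 0.
Proof.
by rewrite /ls_gamma -!scalemxAr !dotvZl /nsq; ring.
Qed.

Lemma ls_gamma_neq0r v x : ls_gamma v x != 0 -> x != 0.
Proof.
by apply: contra => /eqP ->; rewrite /ls_gamma !mulmx0 !nsq0 mulr0 mul0r subr0.
Qed.

Lemma ls_gamma_neq0_comb v x s t : ls_gamma v x != 0 -> s != 0 ->
  s *: v + t *: x != 0.
Proof.
move=> gam0 s0; apply: contra gam0 => /eqP h.
suff -> : v = (- (s^-1 * t)) *: x by rewrite ls_gamma_scaled.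
move: h => /(congr1 (fun w => s^-1 *: w)); rewrite scalerDr !scalerA mulVf//.
by rewrite scale1r scaler0 scaleNr => /eqP; rewrite addr_eq0 => /eqP.
Qed.

Lemma ls_gamma_neq0_line v x t : ls_gamma v x != 0 -> v + t *: x != 0.
Proof.
by move=> gam0; rewrite -[X in X + _]scale1r ls_gamma_neq0_comb// oner_neq0.
Qed.

Lemma ls_gamma_neq0l v x : ls_gamma v x != 0 -> v != 0.
Proof. by move=> /(ls_gamma_neq0_line 0); rewrite scale0r addr0. Qed.

Lemma ls_step_neq0 v x : ls_gamma v x != 0 -> ls_step v x != 0.
Proof.
by move=> gam0; rewrite ls_gamma_neq0_comb// mulf_neq0// pnatr_eq0.
Qed.

Lemma ls_step_tau v x : ls_gamma v x != 0 ->
  ls_step v x = (2 * ls_gamma v x) *: (v + ls_tau v x *: x).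
Proof.
move=> gam0; rewrite /ls_step scalerDr scalerA /ls_tau [_ * (_ / _)]mulrC.
by rewrite divfK// mulf_neq0// pnatr_eq0.
Qed.

Lemma ls_gammaZ v x t : ls_gamma (t *: v) x = t * ls_gamma v x.
Proof. by rewrite /ls_gamma -!scalemxAr !dotvZl; ring. Qed.

(** In [v], [ls_alpha], [ls_beta], [ls_gamma] and [ls_disc] have degrees 3, 2, 1 and 4. The root of
    [t^4] is [t^2] for either sign of [t], so negative factors are covered too. *)
Lemma ls_stepZ v x t : ls_step (t *: v) x = t ^+ 2 *: ls_step v x.
Proof.
have aE : ls_alpha (t *: v) x = t ^+ 3 * ls_alpha v x.
  by rewrite /ls_alpha -!scalemxAr !dotvZl !nsqZ; ring.
have bE : ls_beta (t *: v) x = t ^+ 2 * ls_beta v x.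
  by rewrite /ls_beta -!scalemxAr !nsqZ; ring.
have dE : ls_disc (t *: v) x = (t ^+ 2) ^+ 2 * ls_disc v x.
  by rewrite /ls_disc ls_gammaZ aE bE; ring.
rewrite /ls_step ls_gammaZ bE dE sqrtrM ?sqr_ge0// sqrtr_sqr ger0_norm ?sqr_ge0//.
rewrite scalerDr !scalerA; congr (_ *: _ + _ *: _); ring.
Qed.

Lemma ls_disc_gt0 v x : ls_gamma v x != 0 -> 0 < ls_disc v x.
Proof.
move=> gam0; have v0 := ls_gamma_neq0l gam0.
apply: quotient_disc_gt0 => //; first exact: nsqB_gt0.
have x0 := nsqB_gt0 (ls_gamma_neq0r gam0).
(* Strict Cauchy-Schwarz for [B v] and [B x]: the vector of the usual proof is nonzero by linear
   independence, and so is its image under the injective [B]. *)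
have := nsqB_gt0 (ls_gamma_neq0_comb (- dotv (B *m v) (B *m x)) gam0 (lt0r_neq0 x0)).
rewrite mulmxDr -!scalemxAr nsqD !nsqZ dotvZl dotvZr.
move=> h; rewrite -subr_gt0 -(pmulr_rgt0 _ x0).
by apply: lt_le_trans h _; rewrite le_eqVlt; apply/orP; left; apply/eqP; ring.
Qed.

Lemma ls_gap v x t : ls_gamma v x != 0 ->
  nsq (A *m (v + t *: x)) * nsq (B *m (v + ls_tau v x *: x))
  - nsq (A *m (v + ls_tau v x *: x)) * nsq (B *m (v + t *: x))
  = - Num.sqrt (ls_disc v x) * (t - ls_tau v x) ^+ 2.
Proof.
move=> gam0; rewrite !nsq_line; apply: quotient_gap => //.
  by rewrite sqr_sqrtr ?ltW// ls_disc_gt0.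
by rewrite /ls_tau [LHS]mulrC divfK// mulf_neq0// pnatr_eq0.
Qed.

Lemma is_maximizer_ls_tau v x : ls_gamma v x != 0 ->
  is_maximizer A B v x (ls_tau v x).
Proof.
move=> gam0; split; first exact/eqP/ls_gamma_neq0_line.
move=> t _; rewrite /fquot ler_pdivrMr ?nsqB_gt0 ?ls_gamma_neq0_line//.
rewrite mulrAC ler_pdivlMr ?nsqB_gt0 ?ls_gamma_neq0_line//.
by rewrite -subr_le0 ls_gap// mulNr oppr_le0 mulr_ge0 ?sqrtr_ge0 ?sqr_ge0.
Qed.

(** The factor [Num.sqrt (ls_disc v x)] of the gap is strictly positive, so equality forces
    [t = ls_tau v x]. Thus any choice of maximizer in the algorithm agrees with the explicit
    formula. *)
Lemma is_maximizer_unique v x t : ls_gamma v x != 0 ->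
  is_maximizer A B v x t -> t = ls_tau v x.
Proof.
move=> gam0 [_ /(_ (ls_tau v x))].
move=> /(_ (elimN eqP (ls_gamma_neq0_line _ gam0))).
rewrite /fquot ler_pdivrMr ?nsqB_gt0 ?ls_gamma_neq0_line//.
rewrite mulrAC ler_pdivlMr ?nsqB_gt0 ?ls_gamma_neq0_line//.
rewrite -subr_ge0 ls_gap// mulNr oppr_ge0 pmulr_rle0 ?sqrtr_gt0 ?ls_disc_gt0//.
move=> h; apply/eqP; rewrite -subr_eq0 -sqrf_eq0 eq_le h sqr_ge0//.
Qed.

(** The maximum is at least the value at a short trial step, whose gain has an explicit lower bound
    of order [alpha^2]. *)
Lemma ls_alpha_ascent : exists2 C : R, 0 <= C & forall v x t,
  nsq v = 1 -> nsq x = 1 -> ls_gamma v x != 0 -> is_maximizer A B v x t ->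
  ls_alpha v x ^+ 2 <= C * (fquot A B (v + t *: x) - fquot A B v).
Proof.
have [KA KA0 HA] := mulmx_nsq_bounded A.
have [KB KB0 HB] := mulmx_nsq_bounded B.
pose K := 1 + KA + KB.
have K1 : 1 <= K by rewrite /K; lra.
have K0 : 0 < K by lra.
have bA w : nsq (A *m w) <= K * nsq w.
  by apply: le_trans (HA w) _; rewrite ler_wpM2r ?nsq_ge0// /K; lra.
have bB w : nsq (B *m w) <= K * nsq w.
  by apply: le_trans (HB w) _; rewrite ler_wpM2r ?nsq_ge0// /K; lra.
have dot_le n (M : 'M[R]_(n, d)) v x : (forall w, nsq (M *m w) <= K * nsq w) ->
    nsq v = 1 -> nsq x = 1 -> `|dotv (M *m v) (M *m x)| <= K.
  move=> bM v1 x1; rewrite -(@ler_pXn2r _ 2)// ?nnegrE ?(ltW K0)//.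
  rewrite real_normK ?num_real// (le_trans (dotv_sqr_le _ _))//.
  have := bM v; have := bM x; rewrite v1 x1 mulr1 => ? ?.
  by rewrite expr2 ler_pM// nsq_ge0.
exists (10 * K ^+ 4) => [|v x t v1 x1 gam0 tmax].
  by rewrite mulr_ge0// exprn_ge0// ltW.
have [al0|al0] := eqVneq (ls_alpha v x) 0.
  rewrite al0 expr0n /= mulr_ge0//.
    by rewrite mulr_ge0// exprn_ge0// ltW.
  have [_ /(_ 0)] := tmax; rewrite scale0r addr0 subr_ge0; apply.
  by apply/eqP; exact: (ls_gamma_neq0l gam0).
(* The trial step is short enough that the quadratic term [beta s^2], with [beta >= - K^2], costs at
   most half of the linear gain [2 alpha s]. *)
pose s := ls_alpha v x / K ^+ 2.
have [_ /(_ s)] := tmax; move=> /(_ (elimN eqP (ls_gamma_neq0_line _ gam0))) smax.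
apply: (@le_trans _ _ (10 * K ^+ 4 * (fquot A B (v + s *: x) - fquot A B v))); last first.
  by rewrite ler_wpM2l ?lerD2r// mulr_ge0// exprn_ge0// ltW.
have p0 := nsqB_gt0 (ls_gamma_neq0l gam0).
have m0 := nsqB_gt0 (ls_gamma_neq0_line s gam0).
rewrite /fquot (nsq_line A); rewrite (nsq_line B) in m0 *.
rewrite quotient_diff// -/(ls_alpha v x) -/(ls_beta v x).
rewrite -nsq_line in m0 *.
have K2 : 0 < K ^+ 2 by rewrite exprn_gt0.
have num : ls_alpha v x ^+ 2 / K ^+ 2 <=
    2 * ls_alpha v x * s + ls_beta v x * s ^+ 2.
  have -> : 2 * ls_alpha v x * s + ls_beta v x * s ^+ 2 =
      ls_alpha v x ^+ 2 / K ^+ 2 * (2 + ls_beta v x / K ^+ 2).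
    by rewrite /s; field; rewrite gt_eqF.
  rewrite ler_peMr ?divr_ge0 ?sqr_ge0//.
  suff : - 1 <= ls_beta v x / K ^+ 2 by lra.
  rewrite ler_pdivlMr// mulN1r /ls_beta.
  have h : nsq (A *m v) * nsq (B *m x) <= K ^+ 2.
    rewrite expr2 ler_pM ?nsq_ge0//.
      by have := bA v; rewrite v1 mulr1.
    by have := bB x; rewrite x1 mulr1.
  have := mulr_ge0 (nsq_ge0 (A *m x)) (nsq_ge0 (B *m v)); lra.
have s2 : `|s| <= 2.
  rewrite /s normrM normfV (gtr0_norm K2) ler_pdivrMr// /ls_alpha.
  apply: le_trans (ler_normB _ _) _; rewrite !normrM.
  have -> : 2 * K ^+ 2 = K * K + K * K by rewrite expr2; lra.
  have hA : `|nsq (A *m v)| <= K.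
    by rewrite ger0_norm ?nsq_ge0//; have := bA v; rewrite v1 mulr1.
  have hB : `|nsq (B *m v)| <= K.
    by rewrite ger0_norm ?nsq_ge0//; have := bB v; rewrite v1 mulr1.
  by apply: lerD; apply: ler_pM => //; exact: dot_le.
have den : nsq (B *m v) * nsq (B *m (v + s *: x)) <= K * (K * 10).
  rewrite ler_pM ?nsq_ge0//; first by have := bB v; rewrite v1 mulr1.
  apply: le_trans (bB _) _; rewrite ler_wpM2l ?(ltW K0)//.
  (* By the parallelogram law [nsq (v + s x) <= 2 + 2 s^2 <= 10]; this is the origin of the constant
     10. *)
  have := nsq_ge0 (v - s *: x).
  have : s ^+ 2 <= 2 ^+ 2 by rewrite -(real_normK (num_real s)) ler_pXn2r// nnegrE.
  rewrite -scaleNr !nsqD !nsqZ !dotvZr v1 x1 sqrrN; lra.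
have -> : ls_alpha v x ^+ 2 = 10 * K ^+ 4 * (ls_alpha v x ^+ 2 / K ^+ 2 / (K * (K * 10))).
  by field; rewrite gt_eqF.
rewrite ler_wpM2l ?mulr_ge0 ?exprn_ge0 ?(ltW K0)//.
rewrite ler_pM ?divr_ge0 ?sqr_ge0 ?invr_ge0 ?mulr_ge0 ?(ltW K0) //.
by rewrite lef_pV2 ?posrE ?mulr_gt0.
Qed.

Lemma fquot_bounded : exists C : R, forall v, v != 0 -> fquot A B v <= C.
Proof.
have [KA KA0 HA] := mulmx_nsq_bounded A.
have [KB KB0 HB] := injective_nsq_lower_bound Binj.
exists (KA * KB) => v v0; rewrite /fquot ler_pdivrMr ?nsqB_gt0//.
by apply: le_trans (HA v) _; rewrite -mulrA ler_wpM2l.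
Qed.

Lemma fquotZ t v : t != 0 -> v != 0 -> fquot A B (t *: v) = fquot A B v.
Proof.
move=> t0 v0; rewrite /fquot -!scalemxAr !nsqZ -mulf_div divff ?mul1r//.
by rewrite expf_neq0.
Qed.

Lemma ls_alpha_cvg0 (v x : nat -> 'cV[R]_d) (tau : nat -> R) :
  nsq (v 0) = 1 -> (forall k, nsq (x k) = 1) ->
  (forall k, ls_gamma (v k) (x k) != 0) ->
  (forall k, is_maximizer A B (v k) (x k) (tau k)) ->
  (forall k, v k.+1 =
     (enorm (v k + tau k *: x k))^-1 *: (v k + tau k *: x k)) ->
  (fun k => ls_alpha (v k) (x k)) @ \oo --> (0 : R).
Proof.
move=> v1 x1 gam0 tmax vS.
have line0 k := ls_gamma_neq0_line (tau k) (gam0 k).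
have nv k : nsq (v k) = 1 by case: k => // k; rewrite vS nsq_normalize.
have [C C0 HC] := ls_alpha_ascent.
pose phi k := fquot A B (v k).
have phiS k : phi k.+1 = fquot A B (v k + tau k *: x k).
  by rewrite /phi vS fquotZ// invr_neq0// gt_eqF// enorm_gt0.
have phi_ndecr : nondecreasing_seq phi.
  apply/nondecreasing_seqP => k; rewrite phiS.
  (* The parameter [0] competes in the line search, so the quotient cannot decrease. *)
  have [_ /(_ 0)] := tmax k; rewrite scale0r addr0; apply.
  exact/eqP/(ls_gamma_neq0l (gam0 k)).
have phi_cvg : cvgn phi.
  apply: nondecreasing_is_cvgn => //.
  have [M HM] := fquot_bounded; exists M => _ [k _ <-].
  exact/HM/(ls_gamma_neq0l (gam0 k)).
have dphi : (fun k => C * (phi k.+1 - phi k)) @ \oo --> (0 : R).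
  rewrite -(mulr0 C) -(subrr (limn phi)).
  apply: cvgM; first exact: cvg_cst.
  by apply: cvgB => //; rewrite (cvg_shiftS phi).
have al2 : (fun k => ls_alpha (v k) (x k) ^+ 2) @ \oo --> (0 : R).
  apply: (@squeeze_cvgr _ _ _ _ (fun=> 0) _ _ _ _ (cvg_cst _) dphi).
  by apply: nearW => k; rewrite sqr_ge0 /= phiS; exact: HC.
apply/norm_cvg0P.
have -> : (fun k => `|ls_alpha (v k) (x k)|) =
    Num.sqrt \o (fun k => ls_alpha (v k) (x k) ^+ 2).
  by apply/funext => k; rewrite /= sqrtr_sqr.
rewrite -[X in _ --> X](@sqrtr0 R); apply: continuous_cvg => //.
exact: sqrt_continuous.
Qed.

End LineSearch.

(** * The form [ls_gamma y] is not identically zero *)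

Section NonDegeneracy.
Context {R : realType} {m l d : nat}.
Variables (A : 'M[R]_(m, d)) (B : 'M[R]_(l, d)).
Hypothesis Binj : forall w : 'cV[R]_d, B *m w = 0 -> w = 0.

Lemma dotv_gram p (M : 'M[R]_(p, d)) (u w : 'cV[R]_d) :
  dotv u ((M^T *m M) *m w) = dotv (M *m u) (M *m w).
Proof.
have dotvE n (y z : 'cV[R]_n) : dotv y z = (y^T *m z) 0 0.
  by rewrite mxE; apply: eq_bigr => i _; rewrite mxE.
by rewrite !dotvE trmx_mul !mulmxA.
Qed.

Lemma gram_eq (lam : R) :
  (forall u w : 'cV[R]_d,
     dotv (A *m u) (A *m w) = lam * dotv (B *m u) (B *m w)) ->
  A^T *m A = lam *: (B^T *m B).
Proof.
move=> ABE; apply/matrixP => i j; rewrite [RHS]mxE.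
have gramE p (M : 'M[R]_(p, d)) : (M^T *m M) i j =
    dotv (M *m delta_mx i 0) (M *m delta_mx j 0).
  by rewrite mxE; apply: eq_bigr => k _; rewrite -!colE !mxE.
by rewrite !gramE ABE.
Qed.

(* If [ls_gamma y] vanishes identically then [y] is an eigenvector and the quotient agrees with its value at [y] off the [B^T B]-orthogonal complement of [y], hence everywhere; so there is only one eigenvalue, of full multiplicity. *)
Lemma ls_gamma_nontrivial (lam1 : R) (y : 'cV[R]_d) : y != 0 ->
  largest_gen_eigval A B lam1 -> (dimG A B lam1 < d)%N ->
  exists x, ls_gamma A B y x != 0.
Proof.
move=> y0 [[v [v0 vE]] _] dimd; apply: contrapT => /forallNP gam0.
have {}gam0 x : dotv (A *m y) (A *m x) * nsq (B *m x) =
    nsq (A *m x) * dotv (B *m y) (B *m x).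
  by apply/eqP; rewrite -subr_eq0; apply/negPn/negP; exact: gam0.
have b0 : nsq (B *m y) != 0 by rewrite gt_eqF// nsqB_gt0.
pose lam := nsq (A *m y) / nsq (B *m y).
have lamE : nsq (A *m y) = lam * nsq (B *m y) by rewrite /lam divfK.
have orth x : dotv (B *m y) (B *m x) = 0 -> dotv (A *m y) (A *m x) = 0.
  move=> byx; have [->|x0] := eqVneq x 0; first by rewrite mulmx0 dotv0r.
  have := gam0 x; rewrite byx mulr0 => /eqP.
  by rewrite mulf_eq0 (gt_eqF (nsqB_gt0 Binj x0)) orbF => /eqP.
have linE x : dotv (A *m y) (A *m x) = lam * dotv (B *m y) (B *m x).
  (* Subtracting from [x] its [B^T B]-projection onto [y] reduces to the orthogonal case. *)
  have := orth (x + (- (dotv (B *m y) (B *m x) / nsq (B *m y))) *: y).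
  rewrite !mulmxDr -!scalemxAr !dotvDr !dotvZr -!/(nsq _) lamE => h.
  apply/eqP; rewrite -subr_eq0 -[X in _ == X]h; last by field.
  by apply/eqP; field.
have diagE' x : dotv (B *m y) (B *m x) != 0 -> nsq (A *m x) = lam * nsq (B *m x).
  move=> byx; apply: (mulIf byx); rewrite -gam0 linE; ring.
have diagE x : nsq (A *m x) = lam * nsq (B *m x).
  have [byx|] := eqVneq (dotv (B *m y) (B *m x)) 0; last exact: diagE'.
  (* If [x] is orthogonal to [y], then [x + y] is not; the cross terms vanish by [linE]. *)
  have := diagE' (x + y); rewrite !mulmxDr dotvDr byx add0r -/(nsq _).
  move=> /(_ b0); rewrite !nsqD lamE (dotvC (A *m x)) (dotvC (B *m x)).
  by rewrite linE byx; lra.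
have polE x z : dotv (A *m x) (A *m z) = lam * dotv (B *m x) (B *m z).
  have := diagE (x + z); rewrite !mulmxDr !nsqD !diagE; lra.
have ABE := gram_eq polE.
(* Pairing the eigenvector equation with [v] itself identifies the two values. Then
   [A^T A - lam1 B^T B] is zero and its kernel has dimension [d]. *)
have lam1E : lam1 = lam.
  have := congr1 (dotv v) vE; rewrite dotvZr !dotv_gram polE.
  move=> /mulIf -> //; rewrite -/(nsq _) gt_eqF// nsqB_gt0//; exact/eqP.
by move: dimd; rewrite /dimG lam1E ABE subrr trmx0 mxrank_ker mxrank0 subn0 ltnn.
Qed.

End NonDegeneracy.

(** * Zero sets of polynomials under iterated Lebesgue integration *)

Section PolynomialNullSets.
Context {R : realType}.

Lemma finite_roots (q : {poly R}) : q != 0 -> finite_set [set t | q.[t] = 0].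
Proof.
move: {2}(size q) (leqnn (size q)) => n.
elim: n q => [q|n IHn q qn q0]; first by rewrite leqn0 size_poly_eq0 => /eqP ->; rewrite eqxx.
have [[t qt]|noroot] := pselect (exists t, q.[t] = 0); last first.
  by rewrite (_ : [set t | _] = set0) -?subset0// => t qt; apply: noroot; exists t.
have /factor_theorem[p qE] : root q t by apply/rootP.
have p0 : p != 0 by apply: contra q0 => /eqP p0; rewrite qE p0 mul0r.
have pn : (size p <= n)%N.
  by move: qn; rewrite qE size_Mmonic ?monicXsubC// size_XsubC addn2.
apply: (@sub_finite_set _ _ ([set t] `|` [set t | p.[t] = 0])).
  move=> u /=; rewrite qE hornerM hornerXsubC => /eqP.
  by rewrite mulf_eq0 subr_eq0 => /orP[/eqP ?|/eqP ?]; [right|left].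
by rewrite finite_setU; split; [exact: finite_set1|exact: IHn].
Qed.

(** No measurability of [f] is assumed, since iterated integrals of an arbitrary [h] come with none.
    Every subset of [S] is countable, so a preimage under [f] is countable or cocountable, according
    to whether the target set contains [0]. *)
Lemma integral_off_countable (f : R -> \bar R) (S : set R) : countable S ->
  (forall t, ~ S t -> f t = 0%E) -> (\int[@lebesgue_measure R]_t f t = 0)%E.
Proof.
move=> cS f0.
have mN (E : set R) : E `<=` S -> measurable E.
  move=> ES; apply: countable_measurable; first exact: measurable_set1.
  exact: sub_countable (subset_card_le ES) cS.
rewrite (ae_eq_integral (cst 0%E)) ?integral0//.
- move=> _ Y mY; rewrite setTI.
  have [Y0|Y0] := pselect (Y 0%E); last first.
    by apply: mN => t Yt; apply: contrapT => /f0 ft; apply: Y0; rewrite -ft.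
  rewrite -[X in measurable X]setCK; apply: measurableC; apply: mN => t nY.
  by apply: contrapT => /f0 ft; apply: nY; rewrite /= ft.
- exists S; split; first exact: mN.
    exact: countable_lebesgue_measure0.
  by move=> t /= h; apply: contrapT => /f0 ft; apply: h => _.
Qed.

Variable d : nat.
Implicit Types (p : 'cV[R]_d -> R) (y z : 'cV[R]_d).

(** Polynomial in each coordinate separately: this suffices when integrating one coordinate at a
    time. *)
Definition coord_poly p := forall y j,
  exists q : {poly R}, forall t, p (setcoord y j t) = q.[t].

Lemma coord_poly_cst c : coord_poly (fun=> c).
Proof. by move=> y j; exists c%:P => t; rewrite hornerC. Qed.

Lemma coord_poly_coord i : coord_poly (fun y => y i 0).
Proof.
move=> y j; exists (if (i : nat) == j then 'X else (y i 0)%:P) => t.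
by rewrite mxE; case: ifP => _; rewrite ?hornerX ?hornerC.
Qed.

Lemma coord_polyD p1 p2 : coord_poly p1 -> coord_poly p2 ->
  coord_poly (fun y => p1 y + p2 y).
Proof.
move=> h1 h2 y j; have [q1 E1] := h1 y j; have [q2 E2] := h2 y j.
by exists (q1 + q2) => t; rewrite hornerD E1 E2.
Qed.

Lemma coord_polyM p1 p2 : coord_poly p1 -> coord_poly p2 ->
  coord_poly (fun y => p1 y * p2 y).
Proof.
move=> h1 h2 y j; have [q1 E1] := h1 y j; have [q2 E2] := h2 y j.
by exists (q1 * q2) => t; rewrite hornerM E1 E2.
Qed.

Lemma coord_poly_sum (I : finType) (p : I -> 'cV[R]_d -> R) :
  (forall i, coord_poly (p i)) -> coord_poly (fun y => \sum_i p i y).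
Proof.
move=> h y j; have /choice[q qE] i := h i y j.
exists (\sum_i q i) => t; rewrite horner_sum.
by apply: eq_bigr => i _; rewrite qE.
Qed.

Lemma coord_poly_mulmx n (M : 'M[R]_(n, d)) i : coord_poly (fun y => (M *m y) i 0).
Proof.
rewrite (_ : (fun y => _) = fun y => \sum_j M i j * y j 0); last first.
  by apply/funext => y; rewrite mxE.
apply: coord_poly_sum => j; apply: coord_polyM (coord_poly_coord _).
exact: coord_poly_cst.
Qed.

Lemma coord_poly_dotv n (f g : 'cV[R]_d -> 'cV[R]_n) :
  (forall i, coord_poly (fun y => f y i 0)) ->
  (forall i, coord_poly (fun y => g y i 0)) ->
  coord_poly (fun y => dotv (f y) (g y)).
Proof. by move=> hf hg; apply: coord_poly_sum => i; exact: coord_polyM. Qed.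

Lemma coord_poly_ls_gamma m l (A : 'M[R]_(m, d)) (B : 'M[R]_(l, d)) y :
  coord_poly (ls_gamma A B y).
Proof.
have hM n (M : 'M[R]_(n, d)) i : coord_poly (fun x => (M *m x) i 0).
  exact: coord_poly_mulmx.
have hc n (M : 'M[R]_(n, d)) i : coord_poly (fun x => (M *m y) i 0).
  exact: coord_poly_cst.
rewrite (_ : ls_gamma A B y = fun x =>
    dotv (A *m y) (A *m x) * dotv (B *m x) (B *m x)
    + (-1) * (dotv (A *m x) (A *m x) * dotv (B *m y) (B *m x))); last first.
  by apply/funext => x; rewrite mulN1r.
by apply: coord_polyD; [|apply: coord_polyM; first exact: coord_poly_cst];
  apply: coord_polyM; apply: coord_poly_dotv.
Qed.

Lemma setcoord_id z j : exists t, setcoord z j t = z.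
Proof.
have [jd|jd] := ltnP j d.
  exists (z (Ordinal jd) 0); apply/matrixP => i k; rewrite ord1 mxE.
  by case: eqP => // ij; congr (z _ _); exact: val_inj.
(* An index beyond the dimension changes nothing, so any value serves and [leb_iter] needs no bound
   on [n]. *)
exists 0; apply/matrixP => i k; rewrite ord1 mxE.
by case: eqP => // ij; move: jd; rewrite -ij leqNgt ltn_ord.
Qed.

(* [z] witnesses that [p] does not vanish identically in the first [n] variables, the others being frozen at the values of [y]. *)
Lemma leb_iter_off_zeros p (h : 'cV[R]_d -> \bar R) : coord_poly p ->
  (forall y, p y != 0 -> h y = 0%E) ->
  forall n y z, (forall i : 'I_d, (n <= i)%N -> z i 0 = y i 0) -> p z != 0 ->
  leb_iter n h y = 0%E.
Proof.
move=> pp h0; elim=> [|n IHn] y z zy pz /=.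
  by apply: h0; rewrite (_ : y = z)//; apply/matrixP => i j; rewrite ord1 zy.
have [q qE] := pp z n; have [t0 zE] := setcoord_id z n.
have q0 : q != 0 by apply: contra pz => /eqP q0; rewrite -zE qE q0 horner0.
(* Outside the finitely many roots of [q], the witness with its coordinate [n] set to [t] is a
   witness for the inner integral. *)
apply: (integral_off_countable (finite_set_countable (finite_roots q0))) => t /eqP qt.
apply: (IHn _ (setcoord z n t)); last by rewrite qE.
move=> i ni; rewrite !mxE; case: eqP => // /eqP ine; apply: zy.
by rewrite ltn_neqAle eq_sym ine ni.
Qed.

Lemma lebV_off_zeros p (h : 'cV[R]_d -> \bar R) z : coord_poly p -> p z != 0 ->
  (forall y, p y != 0 -> h y = 0%E) -> lebV h = 0%E.
Proof.
move=> pp pz h0; apply: (leb_iter_off_zeros pp h0 (z := z)) => // i.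
by rewrite leqNgt ltn_ord.
Qed.

(** Closure of the zero set under positive scaling carries the vanishing from the sphere to the cone
    whose volume defines [unif_sphere]. *)
Lemma unif_sphere_off_zeros p (E : set 'cV[R]_d) z : coord_poly p -> p z != 0 ->
  (forall t y, 0 < t -> p y = 0 -> p (t *: y) = 0) ->
  (forall y, E y -> enorm y = 1 -> p y = 0) -> unif_sphere E = 0.
Proof.
move=> pp pz phom pE; rewrite /unif_sphere /lebV_set.
rewrite (lebV_off_zeros pp pz) ?mul0r// => y py.
rewrite indicE memNset// => -[t /andP[t0 _]] [w [Ew w1] yE].
by move/eqP: py; apply; rewrite -yE phom// pE.
Qed.

End PolynomialNullSets.

(** The origin lies in the zero set of the first coordinate. *)
Lemma gauss_std_0 (R : realType) d : (0 < d)%N ->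
  gauss_std [set (0 : 'cV[R]_d)] = 0%E.
Proof.
move=> d0; pose i0 := Ordinal d0.
apply: (@lebV_off_zeros R d (fun y => y i0 0) _ (const_mx 1)).
- exact: coord_poly_coord.
- by rewrite mxE oner_neq0.
- move=> y yi; rewrite indicE memNset ?mul0r// => y0.
  by move: yi; rewrite y0 mxE eqxx.
Qed.

(** * Independence of pairs and Fubini for joint laws *)

Section Independence.
Local Open Scope ereal_scope.
Context {R : realType} {d0 d1 d2 : measure_display} {Omega : measurableType d0}.
Context {T1 : measurableType d1} {T2 : measurableType d2}.
Variables (P : probability Omega R) (U : Omega -> T1) (X : Omega -> T2).
Hypotheses (mU : measurable_fun setT U) (mX : measurable_fun setT X).
Hypothesis indep : forall A B, measurable A -> measurable B ->
  P (U @^-1` A `&` X @^-1` B) = P (U @^-1` A) * P (X @^-1` B).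

Lemma measurable_preimage d' (T' : measurableType d') (f : Omega -> T') A :
  measurable_fun setT f -> measurable A -> measurable (f @^-1` A).
Proof. by move=> mf mA; rewrite -[X in measurable X]setTI; exact: mf. Qed.

(** As functions of [D], both sides are finite measures: the image of [P] restricted to [F], and the
    law of the pair scaled by [P F]. They agree on rectangles, a generating family stable under
    intersection, hence everywhere. *)
Lemma indep_pair_future (F : set Omega) : measurable F ->
  (forall A B, measurable A -> measurable B ->
    P (U @^-1` A `&` X @^-1` B `&` F)
    = P (U @^-1` A) * P (X @^-1` B) * P F) ->
  forall D, measurable D ->
    P ((fun w => (U w, X w)) @^-1` D `&` F)
    = P ((fun w => (U w, X w)) @^-1` D) * P F.
Proof.
move=> mF indepF D mD; pose W w := (U w, X w).
have mW : measurable_fun setT W by exact: measurable_fun_pair.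
have PF : P F = (fine (P F))%:E by rewrite fineK// fin_num_measure.
have PF0 : (0 <= fine (P F))%R by rewrite fine_ge0.
pose W' : {mfun Omega >-> (T1 * T2)%type} := HB.pack W (isMeasurableFun.Build _ _ _ _ W mW).
have [mu1 mu1E] : exists mu : {measure set (T1 * T2) -> \bar R},
    forall D, mu D = P (W @^-1` D `&` F).
  by unshelve eexists (pushforward (mrestr P mF) W).
pose mu2 : {measure set (T1 * T2) -> \bar R} :=
  mscale (NngNum PF0) (distribution P W').
have mu2E D' : mu2 D' = (fine (P F))%:E * P (W @^-1` D') by [].
rewrite muleC PF -mu1E -mu2E.
pose C : set (set (T1 * T2)) :=
  [set C | exists A, measurable A /\ exists B, measurable B /\ C = A `*` B].
apply: (measure_unique C (fun=> setT `*` setT)) => //.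
- rewrite measurable_prod_measurableType; congr (<<s _ >>).
  rewrite predeqE => E; split => [[A mA [B mB <-]]|[A [mA [B [mB ->]]]]].
    by exists A; split => //; exists B.
  by exists A => //; exists B.
- move=> /= _ _ [X1 [mX1 [X2 [mX2 ->]]]] [Y1 [mY1 [Y2 [mY2 ->]]]].
  rewrite -setXI; exists (X1 `&` Y1); split; first exact: measurableI.
  by exists (X2 `&` Y2); split => //; exact: measurableI.
- by move=> _; exists setT; split => //; exists setT.
- by rewrite setXTT bigcup_const.
- move=> _ [A [mA [B [mB ->]]]].
  rewrite mu1E mu2E -PF.
  have -> : W @^-1` (A `*` B) = U @^-1` A `&` X @^-1` B by [].
  by rewrite indepF// indep// muleC.
- by move=> _; rewrite mu1E setXTT preimage_setT setTI PF ltry.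
Qed.

(** Independence makes the joint law the product law, whose value on [D] is the integral of the
    section probabilities. *)
Lemma indep_null_sections (D : set (T1 * T2)) : measurable D ->
  (forall y, P (X @^-1` xsection D y) = 0) ->
  P ((fun w => (U w, X w)) @^-1` D) = 0.
Proof.
move=> mD null; pose W w := (U w, X w).
have mW : measurable_fun setT W by exact: measurable_fun_pair.
pose U' : {mfun Omega >-> T1} := HB.pack U (isMeasurableFun.Build _ _ _ _ U mU).
pose X' : {mfun Omega >-> T2} := HB.pack X (isMeasurableFun.Build _ _ _ _ X mX).
pose W' : {mfun Omega >-> (T1 * T2)%type} := HB.pack W (isMeasurableFun.Build _ _ _ _ W mW).
have -> : P (W @^-1` D) = distribution P W' D by [].
rewrite -(@product_measure_unique _ _ _ _ _ (distribution P U')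
  (distribution P X') (distribution P W'))//.
by apply: integral0_eq => y _; exact: null.
Qed.

End Independence.

(** * The coordinate sigma-algebra on column vectors *)

Section BorelVectors.
Context {R : realType} {d : nat}.

Definition coord_gen : set (set 'cV[R]_d) :=
  [set (fun v : 'cV[R]_d => v i 0) @^-1` E | i in [set: 'I_d] &
     E in [set E : set R | measurable E]].

(* The measurable sets of [Vec] are, definitionally, those of [borelV]. *)
Definition Vec := g_sigma_algebraType coord_gen.

Lemma measurable_coord (i : 'I_d) :
  measurable_fun setT (fun y : Vec => (y : 'cV[R]_d) i 0).
Proof.
move=> _ E mE; rewrite setTI; apply: sub_sigma_algebra.
by exists i => //; exists E.
Qed.

Lemma measurable_into_Vec {d1} {T : measurableType d1} (f : T -> 'cV[R]_d) :
  (forall i, measurable_fun setT (fun t => f t i 0)) ->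
  measurable_fun setT (f : T -> Vec).
Proof.
move=> mf; apply: (@measurability _ _ T Vec setT f coord_gen) => //.
move=> _ [_ [i _ [E mE <-]] <-]; rewrite setTI.
by rewrite -[X in measurable X]setTI; exact: mf.
Qed.

End BorelVectors.
Arguments Vec : clear implicits.

(** * Measurability of the line-search step *)

Section MeasurableStep.
Context {R : realType} {d1 : measure_display} {T : measurableType d1}.

Definition mcoord n (f : T -> 'cV[R]_n) :=
  forall i, measurable_fun setT (fun t => f t i 0).

Lemma mcoord_mulmx n p (M : 'M[R]_(p, n)) (f : T -> 'cV[R]_n) :
  mcoord f -> mcoord (fun t => M *m f t).
Proof.
move=> mf i.
rewrite (_ : (fun t => _) = fun t => \sum_j M i j * f t j 0); last first.
  by apply/funext => t; rewrite mxE.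
by apply: measurable_sum => j; exact: measurable_funM.
Qed.

Lemma measurable_dotv n (f h : T -> 'cV[R]_n) : mcoord f -> mcoord h ->
  measurable_fun setT (fun t => dotv (f t) (h t)).
Proof.
by move=> mf mh; apply: measurable_sum => i; exact: measurable_funM.
Qed.

Context {m l d : nat}.
Variables (A : 'M[R]_(m, d)) (B : 'M[R]_(l, d)) (f h : T -> 'cV[R]_d).
Hypotheses (mf : mcoord f) (mh : mcoord h).

Let mdot p (M : 'M[R]_(p, d)) (f1 f2 : T -> 'cV[R]_d) :
  mcoord f1 -> mcoord f2 ->
  measurable_fun setT (fun t => dotv (M *m f1 t) (M *m f2 t)).
Proof. by move=> ? ?; apply: measurable_dotv; exact: mcoord_mulmx. Qed.

Lemma measurable_ls_alpha : measurable_fun setT (fun t => ls_alpha A B (f t) (h t)).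
Proof. by apply: measurable_funB; apply: measurable_funM; exact: mdot. Qed.

Lemma measurable_ls_beta : measurable_fun setT (fun t => ls_beta A B (f t) (h t)).
Proof. by apply: measurable_funB; apply: measurable_funM; exact: mdot. Qed.

Lemma measurable_ls_gamma : measurable_fun setT (fun t => ls_gamma A B (f t) (h t)).
Proof. by apply: measurable_funB; apply: measurable_funM; exact: mdot. Qed.

Lemma mcoord_ls_step : mcoord (fun t => ls_step A B (f t) (h t)).
Proof.
move=> i; rewrite (_ : (fun t => _) = fun t =>
    2 * ls_gamma A B (f t) (h t) * f t i 0 +
    (ls_beta A B (f t) (h t) + Num.sqrt (ls_disc A B (f t) (h t))) * h t i 0);
  last by apply/funext => t; rewrite !mxE.
have mg := measurable_ls_gamma; have mb := measurable_ls_beta.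
have ma := measurable_ls_alpha.
apply: measurable_funD; apply: measurable_funM => //.
  exact: measurable_funM.
apply: measurable_funD => //.
apply: (@measurableT_comp _ _ _ _ _ _ (@Num.sqrt R)).
  apply: continuous_measurable_fun; exact: sqrt_continuous.
apply: measurable_funD; first exact: measurable_funX.
by apply: measurable_funM => //; exact: measurable_funM.
Qed.

End MeasurableStep.

(** * Independence of each iterate from the later samples *)

Section CanonicalIterates.
Context {R : realType} {m l d : nat}.
Variables (A : 'M[R]_(m, d)) (B : 'M[R]_(l, d)).
Context {d0 : measure_display} {Omega : measurableType d0}.
Variables (P : probability Omega R) (X : option nat -> Omega -> 'cV[R]_d).
Hypotheses (mX : forall o, rand_vec (X o)) (indX : mutually_indep P X).

(* The unnormalized iterates. As [tau k] is only assumed measurable, independence of the past and the future has to be established for these, which are explicit functions of the samples. *)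
Fixpoint raw_iter k w : 'cV[R]_d :=
  if k is k'.+1 then ls_step A B (raw_iter k' w) (X (Some k') w) else X None w.

Lemma measurable_rand_vec (Y : Omega -> 'cV[R]_d) :
  rand_vec Y -> measurable_fun setT (Y : Omega -> Vec R d).
Proof. by move=> mY _ E mE; rewrite setTI; exact: mY. Qed.

Lemma mcoord_Vec {d1} {T : measurableType d1} (f : T -> 'cV[R]_d) :
  measurable_fun setT (f : T -> Vec R d) -> mcoord f.
Proof. by move=> mf i; exact: (measurableT_comp (measurable_coord i) mf). Qed.

Lemma measurable_raw_iter k : measurable_fun setT (raw_iter k : Omega -> Vec R d).
Proof.
elim: k => [|k IHk]; first exact: (measurable_rand_vec (mX None)).
apply: measurable_into_Vec; apply: mcoord_ls_step; apply: mcoord_Vec => //.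
exact: (measurable_rand_vec (mX (Some k))).
Qed.

(** These are the events to which [mutually_indep] applies directly. *)
Definition cylinder (S : set (option nat)) (F : set Omega) :=
  exists J E, [/\ uniq J, forall j, j \in J -> S j,
    forall j, j \in J -> borelV (E j) &
    F = \bigcap_(j in [set j | j \in J]) (X j @^-1` E j)].

Lemma measurable_cylinder S F : cylinder S F -> measurable F.
Proof.
move=> [J [E [_ _ mE ->]]]; apply: fin_bigcap_measurable => [|j Jj].
  exact: finite_seq.
exact: (mX j (mE j Jj)).
Qed.

Lemma sub_cylinder S S' F : S `<=` S' -> cylinder S F -> cylinder S' F.
Proof.
by move=> SS' [J [E [uJ SJ mE ->]]]; exists J, E; split=> // j /SJ /SS'.
Qed.

Lemma cylinderT S : cylinder S setT.
Proof.
by exists [::], (fun=> setT); split=> //; rewrite bigcapT.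
Qed.

Lemma cylinder_cons S F i G : cylinder S F -> ~ S i -> borelV G ->
  cylinder (i |` S) (X i @^-1` G `&` F) /\
  P (X i @^-1` G `&` F) = (P (X i @^-1` G) * P F)%E.
Proof.
move=> [J [E [uJ SJ mE FE]]] nSi mG.
have iJ : i \notin J by apply/negP => /SJ.
pose E' j := if j == i then G else E j.
have E'i : E' i = G by rewrite /E' eqxx.
have E'J j : j \in J -> E' j = E j.
  by move=> Jj; rewrite /E'; case: eqP => // ji; rewrite -ji Jj in iJ.
have mE' j : j \in i :: J -> borelV (E' j).
  by rewrite inE => /predU1P[->|Jj]; rewrite ?E'i// E'J//; exact: mE.
have uJ' : uniq (i :: J) by rewrite /= iJ.
have GE : X i @^-1` G `&` F =
    \bigcap_(j in [set j | j \in i :: J]) (X j @^-1` E' j).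
  rewrite FE; apply/seteqP; split => [w [Gw Fw] j /=|w h].
    rewrite inE => /predU1P[->|Jj]; rewrite ?E'i// E'J//; exact: Fw.
  split; first by rewrite -E'i; apply: h; rewrite /= mem_head.
  by move=> j /= Jj; rewrite -E'J//; apply: h; rewrite /= inE Jj orbT.
split; first exists (i :: J), E'.
  split=> // j; rewrite inE => /predU1P[->|/SJ]; by [left|right].
rewrite GE indX// big_cons E'i FE indX//; congr (_ * _)%E.
by apply: eq_big_seq => j Jj; rewrite E'J.
Qed.

(** [None] indexes the initial vector and belongs to no future. *)
Definition future k : set (option nat) :=
  [set o | if o is Some n then (k <= n)%N else false].

Lemma futureS_sub k : Some k |` future k.+1 `<=` future k.
Proof.
by move=> o [->|]; rewrite /future /=; [exact: leqnn|case: o => // n /ltnW].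
Qed.

Lemma notin_futureS k : ~ future k.+1 (Some k).
Proof. by rewrite /future /= ltnn. Qed.

(** Allowing every cylinder of the future makes the induction work: for [F] in the future of
    [k + 1], an event about [X (Some k)] intersected with [F] is a cylinder in the future of [k].
    The induction hypothesis then factors all rectangles for the pair [(raw_iter k, X (Some k))],
    and [indep_pair_future] passes to preimages under the step. *)
Lemma raw_iter_indep_future k F (E : set 'cV[R]_d) :
  cylinder (future k) F -> borelV E ->
  P (raw_iter k @^-1` E `&` F) = (P (raw_iter k @^-1` E) * P F)%E.
Proof.
elim: k F E => [|k IHk] F E cF mE.
  have nN : ~ future 0 None by [].
  by have [] := cylinder_cons cF nN mE.
have nk := @notin_futureS k.
have mu := measurable_raw_iter k.
have mx := measurable_rand_vec (mX (Some k)).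
pose step (z : Vec R d * Vec R d) : Vec R d := ls_step A B z.1 z.2.
have mstep : measurable_fun setT step.
  apply: measurable_into_Vec; apply: mcoord_ls_step; apply: mcoord_Vec.
    exact: measurable_fst.
  exact: measurable_snd.
have mD : measurable (step @^-1` E) by exact: measurable_preimage.
apply: (@indep_pair_future _ _ _ _ _ (Vec R d) (Vec R d) P _ _ mu mx _ F _ _
  (step @^-1` E) mD).
(* Independence within the pair is the case where the remaining future event is [setT]. *)
- move=> C D mC mD'; have [cD _] := cylinder_cons (cylinderT (future k.+1)) nk mD'.
  by rewrite setIT in cD; rewrite (IHk _ C (sub_cylinder (@futureS_sub k) cD) mC).
- exact: measurable_cylinder cF.
- move=> C D mC mD'; have [cD PD] := cylinder_cons cF nk mD'.
  by rewrite -setIA (IHk _ C (sub_cylinder (@futureS_sub k) cD) mC) PD muleA.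
Qed.

Lemma raw_iter_indep k (C D : set 'cV[R]_d) : borelV C -> borelV D ->
  P (raw_iter k @^-1` C `&` X (Some k) @^-1` D) =
  (P (raw_iter k @^-1` C) * P (X (Some k) @^-1` D))%E.
Proof.
move=> mC mD.
have [cD _] := cylinder_cons (cylinderT _) (@notin_futureS k) mD.
rewrite setIT in cD; apply: raw_iter_indep_future => //.
exact: sub_cylinder (@futureS_sub k) cD.
Qed.

End CanonicalIterates.

(** * Almost sure non-degeneracy and the conclusion *)

Lemma negligible_bad_direction (R : realType) (d m l : nat)
  (A : 'M[R]_(m, d)) (B : 'M[R]_(l, d))
  (d0 : measure_display) (Omega : measurableType d0) (P : probability Omega R)
  (U X : Omega -> 'cV[R]_d) (lam1 : R) :
  (forall w : 'cV[R]_d, B *m w = 0 -> w = 0) ->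
  largest_gen_eigval A B lam1 -> (dimG A B lam1 < d)%N ->
  measurable_fun setT (U : Omega -> Vec R d) -> rand_vec X ->
  law_unif_sphere P X ->
  (forall C D : set 'cV[R]_d, borelV C -> borelV D ->
    P (U @^-1` C `&` X @^-1` D) = (P (U @^-1` C) * P (X @^-1` D))%E) ->
  P.-negligible [set w | U w != 0 /\
    (ls_gamma A B (U w) (X w) = 0 \/ nsq (X w) != 1)].
Proof.
move=> Binj lam1max dimd mU rX lX UX.
(* The zero vector is excluded because [ls_gamma] vanishes there in every direction. Non-unit
   directions are included because the law gives norm 1 only almost surely. *)
pose D : set (Vec R d * Vec R d) := [set z | nsq (z.1 : 'cV[R]_d) != 0 /\
    (ls_gamma A B z.1 z.2 = 0 \/ nsq (z.2 : 'cV[R]_d) != 1)].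
have mX := measurable_rand_vec rX.
have m1 : mcoord (fun z : Vec R d * Vec R d => z.1 : 'cV[R]_d).
  by apply: mcoord_Vec; exact: measurable_fst.
have m2 : mcoord (fun z : Vec R d * Vec R d => z.2 : 'cV[R]_d).
  by apply: mcoord_Vec; exact: measurable_snd.
have mpre (f : Vec R d * Vec R d -> R) (c : R) : measurable_fun setT f ->
    measurable [set z | f z = c].
  by move=> mf; exact: (measurable_preimage (A := [set c]) mf).
have mpreC (f : Vec R d * Vec R d -> R) (c : R) : measurable_fun setT f ->
    measurable [set z | f z != c].
  move=> mf; rewrite (_ : [set z | _] = ~` [set z | f z = c]).
    by apply: measurableC; exact: mpre.
  by apply/seteqP; split => z /= /eqP.
have mD : measurable D.
  apply: measurableI; first by apply: mpreC; exact: measurable_dotv.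
  apply: measurableU; first by apply: mpre; exact: measurable_ls_gamma.
  by apply: mpreC; exact: measurable_dotv.
exists ((fun w => (U w, X w)) @^-1` D); split.
- apply: (measurable_preimage (T' := (Vec R d * Vec R d)%type) _ mD).
  exact: measurable_fun_pair.
- apply: (indep_null_sections mU mX UX mD) => y.
  have -> : X @^-1` xsection D y = X @^-1` [set x | D (y, x)].
    by rewrite xsectionE.
  have [y0|y0] := eqVneq (nsq (y : 'cV[R]_d)) 0.
    rewrite (_ : X @^-1` _ = set0) ?measure0// -subset0 => w [] /=.
    by rewrite y0 eqxx.
  have mDy : borelV [set x | D (y, x)].
    by have := @measurable_xsection _ _ _ _ D y mD; rewrite xsectionE.
  rewrite lX//.
  have yn0 : (y : 'cV[R]_d) != 0 by apply: contra y0 => /eqP ->; rewrite nsq0.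
  have [z gz] := ls_gamma_nontrivial Binj yn0 lam1max dimd.
  rewrite (unif_sphere_off_zeros (coord_poly_ls_gamma A B y) gz)//.
    move=> t x _ gx; transitivity (t ^+ 3 * ls_gamma A B y x).
      by rewrite /ls_gamma -!scalemxAr !dotvZr !nsqZ; ring.
    by rewrite gx mulr0.
  move=> x [_ [//|/= x1]] xn; move/eqP: x1 => []; rewrite -[LHS]sqr_sqrtr ?nsq_ge0//.
  by rewrite -/(enorm x) xn expr1n.
- move=> w [U0 h]; split => //=; apply: contra U0 => /eqP/nsq_eq0 -> //.
Qed.

Lemma negligible_gauss_eq0 (R : realType) (d : nat)
  (d0 : measure_display) (Omega : measurableType d0) (P : probability Omega R)
  (g : Omega -> 'cV[R]_d) : (0 < d)%N -> rand_vec g -> law_gauss_std P g ->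
  P.-negligible [set w | g w = 0].
Proof.
move=> d_gt0 rg lg.
have b0 : borelV [set (0 : 'cV[R]_d)].
  have -> : [set (0 : 'cV[R]_d)] = (fun y : Vec R d => nsq (y : 'cV[R]_d)) @^-1` [set 0].
    by apply/seteqP; split => y /= => [->|/nsq_eq0//]; exact: nsq0.
  apply: (@measurable_preimage _ (Vec R d)) => //.
  by apply: measurable_dotv; apply: mcoord_Vec; exact: measurable_id.
exists (g @^-1` [set 0]); split => //; first exact: rg.
by rewrite lg// gauss_std_0.
Qed.

Theorem mainTheorem2 (R : realType) (d m l : nat)
  (A : 'M[R]_(m, d)) (B : 'M[R]_(l, d))
  (d0 : measure_display) (Omega : measurableType d0) (P : probability Omega R)
  (g : Omega -> 'cV[R]_d) (x : nat -> Omega -> 'cV[R]_d)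
  (v : nat -> Omega -> 'cV[R]_d) (tau : nat -> Omega -> R) (lam1 : R) :
  (2 <= d)%N ->
  (forall w : 'cV[R]_d, B *m w = 0 -> w = 0) ->
  largest_gen_eigval A B lam1 ->
  (dimG A B lam1 < d - 1)%N ->
  (* randomness of Algorithm U *)
  rand_vec g -> law_gauss_std P g ->
  (forall k, rand_vec (x k)) -> (forall k, law_unif_sphere P (x k)) ->
  mutually_indep P (fun o : option nat =>
                      match o with None => g | Some k => x k end) ->
  (* iterates of Algorithm U *)
  (forall w, v 0%N w = (enorm (g w))^-1 *: g w) ->
  (forall k, measurable_fun setT (tau k)) ->
  (forall k w, if `[< exists t, is_maximizer A B (v k w) (x k w) t >]
               then is_maximizer A B (v k w) (x k w) (tau k w)
               else tau k w = 0) ->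
  (forall k w, v k.+1 w =
     (enorm (v k w + tau k w *: x k w))^-1 *: (v k w + tau k w *: x k w)) ->
  {ae P, forall w,
     (fun k => dotv (A *m v k w) (A *m x k w) * nsq (B *m v k w)
               - nsq (A *m v k w) * dotv (B *m v k w) (B *m x k w))
     @ \oo --> (0 : R)}.
Proof.
move=> d2 Binj lam1max dimd rg lg rx lx indX v0E _ tauE vS.
have d_gt0 : (0 < d)%N by exact: leq_trans d2.
have {}dimd : (dimG A B lam1 < d)%N by apply: leq_trans dimd _; exact: leq_subr.
pose X o := if o is Some k then x k else g.
have rX o : rand_vec (X o) by case: o.
have {}indX : mutually_indep P X.
  by rewrite (_ : X = fun o => match o with None => g | Some k => x k end).
pose u := raw_iter A B X.
have Nk k := negligible_bad_direction Binj lam1max dimd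
  (measurable_raw_iter A B rX k) (rx k) (lx k) (@raw_iter_indep _ _ _ _ A B _ _ P X rX indX k).
have N0 := negligible_gauss_eq0 d_gt0 rg lg.
(* The exceptional event is a zero start or a bad direction at some step, a countable union of null
   events; the rest is deterministic. *)
apply: negligibleS (negligibleU N0 (negligible_bigcup Nk)) => w /=.
apply: contra_notP => /not_orP[g0 nbad].
have good k : u k w != 0 ->
    ls_gamma A B (u k w) (x k w) != 0 /\ nsq (x k w) = 1.
  move=> u0; split.
    by apply/eqP => gam0; apply: nbad; exists k => //; split => //; left.
  by apply/eqP/negPn/negP => x1; apply: nbad; exists k => //; split => //; right.
have u0 k : u k w != 0.
  elim: k => [|k IHk]; first exact/eqP.
  exact/ls_step_neq0/(good k IHk).1.
(* The factor [c] may be negative, since [ls_step] carries the factor [2 ls_gamma]. It still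
   transfers [ls_gamma != 0] from the raw iterate to [v k]. *)
have vu k : exists2 c, c != 0 & v k w = c *: u k w.
  elim: k => [|k [c c0 vE]].
    by exists (enorm (g w))^-1 => //; rewrite invr_neq0// gt_eqF// enorm_gt0// (u0 0).
  have gam0 : ls_gamma A B (v k w) (x k w) != 0.
    by rewrite vE ls_gammaZ mulf_neq0// (good k (u0 k)).1.
  (* A maximizer exists here, so the default value [0] of [tau k] does not occur. *)
  have tauk : tau k w = ls_tau A B (v k w) (x k w).
    apply: (is_maximizer_unique Binj gam0); have := tauE k w.
    by case: asboolP => // -[]; exists (ls_tau A B (v k w) (x k w)); exact: is_maximizer_ls_tau.
  have uS : u k.+1 w = (c ^+ 2)^-1 *: ((2 * ls_gamma A B (v k w) (x k w)) *:
      (v k w + tau k w *: x k w)).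
    rewrite tauk -ls_step_tau// vE ls_stepZ scalerA mulVf ?scale1r//.
    by rewrite expf_neq0.
  have q0 : (c ^+ 2)^-1 * (2 * ls_gamma A B (v k w) (x k w)) != 0.
    by rewrite mulf_neq0 ?invr_neq0 ?expf_neq0// mulf_neq0// pnatr_eq0.
  have n0 : (enorm (v k w + tau k w *: x k w))^-1 != 0.
    by rewrite invr_neq0// gt_eqF// enorm_gt0// (ls_gamma_neq0_line _ gam0).
  exists ((enorm (v k w + tau k w *: x k w))^-1 /
    ((c ^+ 2)^-1 * (2 * ls_gamma A B (v k w) (x k w)))).
    by rewrite mulf_neq0// invr_neq0.
  by rewrite vS uS (scalerA (c ^+ 2)^-1) scalerA divfK.
have gam0 k : ls_gamma A B (v k w) (x k w) != 0.
  by have [c c0 ->] := vu k; rewrite ls_gammaZ mulf_neq0// (good k (u0 k)).1.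
apply: (@ls_alpha_cvg0 _ _ _ _ _ _ Binj (fun k => v k w) (fun k => x k w)
  (fun k => tau k w)) => //.
- by rewrite v0E nsq_normalize// (u0 0).
- by move=> k; rewrite (good k (u0 k)).2.
- move=> k; have := tauE k w; case: asboolP => // -[].
  by exists (ls_tau A B (v k w) (x k w)); exact: is_maximizer_ls_tau.
Qed.
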